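(* Let $\mathcal{M}$ be a smooth $n$-dimensional manifold, and for each $i\in\{1,\dots,N\}$ let $\{f_{i,j}\}_{j=1}^{d_i}$ be smooth vector fields on $\mathcal{M}$, let $J_i:\mathcal{M}\to\mathbb{R}$ be a smooth function, and let $\kappa_i>0$. Suppose that there is an open submanifold $\mathcal{U}\subset\mathcal{M}$ such that, with $\mathcal{E}_i(x):=\mathrm{span}_{\mathbb{R}}\{f_{i,j}(x)\}_{j=1}^{d_i}$, each $\mathcal{E}_i$ is a regular distribution on $\mathcal{U}$ and $$T_x\mathcal{U}=\mathcal{E}_1(x)\oplus\cdots\oplus\mathcal{E}_N(x)\qquad\text{for all }x\in\mathcal{U}.$$ Then there exists a Riemannian metric $g$ on $\mathcal{U}$ such that, on $\mathcal{U}$, the system $$\dot{x}=\sum_{i=1}^N\kappa_i\sum_{j=1}^{d_i}L_{f_{i,j}}(J_i)(x)\,f_{i,j}(x)$$ takes the form $$\dot{x}=\sum_{i=1}^N\kappa_i\,\mathrm{grad}_{\mathcal{E}_i}(J_i)(x),$$ where $\mathrm{grad}_{\mathcal{E}_i}(J_i)$ is the vector field obtained by $g$-orthogonal projection of $\mathrm{grad}(J_i)$ onto $\mathcal{E}_i$.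
   Context: $L_fJ(x)=dJ(x)[f(x)]$ is the Lie derivative of the function $J$ along the vector field $f$. A regular distribution is a smooth distribution of constant rank. For a Riemannian metric $g$ on $\mathcal{U}$, $\mathrm{grad}(J)$ is the unique vector field with $g(\mathrm{grad}(J),X)=dJ[X]$ for all vector fields $X$. For a smooth subbundle $\mathcal{E}\subset T\mathcal{U}$ with $g$-orthogonal projection $P_{\mathcal{E}}:T\mathcal{U}\to\mathcal{E}$, $\mathrm{grad}_{\mathcal{E}}(J):=P_{\mathcal{E}}\,\mathrm{grad}(J)$. The vector fields $f_{i,j}$ need not be linearly independent. *)

(* Defs.v *)
From HB Require Import structures.
From mathcomp Require Import all_boot all_order all_algebra.
From mathcomp Require Import all_classical all_reals all_analysis.

Set Implicit Arguments.
Unset Strict Implicit.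
Unset Printing Implicit Defensive.

Import Order.TTheory GRing.Theory Num.Theory.
Import numFieldNormedType.Exports.

Local Open Scope classical_set_scope.
Local Open Scope ring_scope.

(* Functions between normed spaces are total; only their values on the open
   set [O] matter below, since continuity and differentiability at a point of
   an open set depend on the germ of the function only. *)
Fixpoint Ck {R : realType} {V W : normedModType R} (k : nat) (O : set V)
    (f : V -> W) : Prop :=
  if k is k'.+1 then
    (forall x, O x -> differentiable f x) /\ (forall v, Ck k' O ('D_v f))
  else forall x, O x -> {for x, continuous f}.

Definition smooth_on {R : realType} {V W : normedModType R} (O : set V)
    (f : V -> W) : Prop :=
  forall k, Ck k O f.

Lemma near_eq_diff {R : realType} {V W : normedModType R} (f g : V -> W) x :
  (\near x, f x = g x) -> differentiable f x ->
  differentiable g x /\ 'd g x = 'd f x :> (V -> W).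
Proof.
move=> fg df.
have fgx : f x = g x by exact: nbhs_singleton fg.
have gE : g \o shift x = cst (g x) + 'd f x +o_ 0 id.
  apply: eqaddoE; rewrite -fgx; apply/eqaddoP => e e0.
  have /eqaddoP/(_ e e0) := diff_locally df.
  have fg0 : \forall h \near (0 : V), f (h + x) = g (h + x).
    have := fg; rewrite (near_shift 0 x (fun z => f z = g z)).
    by apply: filterS => z /=; rewrite subr0.
  apply: filterS2 fg0.
  by move=> h; rewrite !fctE /= => ->.
have dg : 'd g x = 'd f x :> (V -> W).
  by apply: diff_unique gE; exact: diff_continuous.
split=> //; apply/diff_locallyP; rewrite dg; split=> //.
exact: diff_continuous.
Qed.

(* A homeomorphism from an open subset of [M] onto an open subset of R^n, both
   directions being extended arbitrarily to total functions. *)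
Record chart (R : realType) (n : nat) (M : topologicalType) := Chart {
  chart_dom : set M ;
  chart_cod : set 'rV[R]_n ;
  chart_fun : M -> 'rV[R]_n ;
  chart_inv : 'rV[R]_n -> M ;
  chart_dom_open : open chart_dom ;
  chart_cod_open : open chart_cod ;
  chart_fun_cod : forall x, chart_dom x -> chart_cod (chart_fun x) ;
  chart_inv_dom : forall y, chart_cod y -> chart_dom (chart_inv y) ;
  chart_funK : forall x, chart_dom x -> chart_inv (chart_fun x) = x ;
  chart_invK : forall y, chart_cod y -> chart_fun (chart_inv y) = y ;
  chart_fun_continuous :
    forall x, chart_dom x -> {for x, continuous chart_fun} ;
  chart_inv_continuous :
    forall y, chart_cod y -> {for y, continuous chart_inv} }.

(* The image under the chart [c] of the part of [U] covered by [c]. *)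
Definition chart_image (R : realType) (n : nat) (M : topologicalType)
    (c : chart R n M) (U : set M) : set 'rV[R]_n :=
  [set y | chart_cod c y /\ U (chart_inv c y)].

(* The smooth structure is the one determined by the (not necessarily maximal)
   smooth atlas [atlas]. *)
Record smooth_manifold (R : realType) (n : nat) := SmoothManifold {
  carrier :> topologicalType ;
  manifold_hausdorff : hausdorff_space carrier ;
  manifold_second_countable : @second_countable carrier ;
  atlas_index : Type ;
  atlas : atlas_index -> chart R n carrier ;
  atlas_cover : forall x, exists i, chart_dom (atlas i) x ;
  atlas_smooth : forall i j,
    smooth_on (chart_image (atlas i) (chart_dom (atlas j)))
              (chart_fun (atlas j) \o chart_inv (atlas i)) }.

Arguments atlas {R n} M i : rename.
Arguments atlas_index {R n} M : rename.

Section Tangent.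
Context {R : realType} {n : nat} (M : smooth_manifold R n).
Implicit Types (i j k : atlas_index M) (x : M).

Definition transition i j : 'rV[R]_n -> 'rV[R]_n :=
  chart_fun (atlas M j) \o chart_inv (atlas M i).

Definition chart_at x : atlas_index M := projT1 (cid (atlas_cover x)).

Lemma chart_atP x : chart_dom (atlas M (chart_at x)) x.
Proof. exact: projT2 (cid (atlas_cover x)). Qed.

(* A tangent vector at [x] is given by its component vectors in all charts
   around [x], which are related by the differentials of the transition maps.
   Charts that do not contain [x] receive the dummy component vector 0. *)
Definition is_tangent x (v : atlas_index M -> 'rV[R]_n) : Prop :=
  (forall i, ~ chart_dom (atlas M i) x -> v i = 0) /\
  (forall i j, chart_dom (atlas M i) x -> chart_dom (atlas M j) x ->
     v j = 'd (transition i j) (chart_fun (atlas M i) x) (v i)).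

Definition tangent_pred x : {pred atlas_index M -> 'rV[R]_n} :=
  fun v => `[< is_tangent x v >].

Record tangent x := Tangent {
  components :> atlas_index M -> 'rV[R]_n ;
  componentsP : components \in tangent_pred x }.

Lemma tangent_pred_submod x : submod_closed (tangent_pred x).
Proof.
split=> [|a u v].
  by apply/asboolP; split=> // i j _ _; rewrite linear0.
have E l : (a *: u + v) l = a *: u l + v l by [].
move=> /asboolP[u0 uP] /asboolP[v0 vP]; apply/asboolP; split.
  by move=> i ix; rewrite E u0// v0// scaler0 addr0.
by move=> i j ix jx; rewrite !E linearP -uP// -vP.
Qed.

HB.instance Definition _ x :=
  GRing.isSubmodClosed.Build R (atlas_index M -> 'rV[R]_n) (tangent_pred x)
    (tangent_pred_submod x).

HB.instance Definition _ x := [isSub for @components x].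
HB.instance Definition _ x := [Choice of tangent x by <:].
HB.instance Definition _ x := [SubChoice_isSubZmodule of tangent x by <:].
HB.instance Definition _ x := [SubZmodule_isSubLmodule of tangent x by <:].

Lemma componentsD x (u v : tangent x) i : (u + v) i = u i + v i.
Proof. by []. Qed.

Lemma componentsZ x a (v : tangent x) i : (a *: v) i = a *: v i.
Proof. by []. Qed.

Lemma tangent_out x (v : tangent x) i :
  ~ chart_dom (atlas M i) x -> v i = 0.
Proof. by case: v => v /= /asboolP[+ _]; apply. Qed.

Lemma tangentE x (v : tangent x) i j :
  chart_dom (atlas M i) x -> chart_dom (atlas M j) x ->
  v j = 'd (transition i j) (chart_fun (atlas M i) x) (v i).
Proof. by case: v => v /= /asboolP[_]; apply. Qed.

Lemma chart_image_open i (U : set M) :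
  open U -> open (chart_image (atlas M i) U).
Proof.
move=> oU; rewrite openE => y [yc yU]; rewrite /interior.
apply: filterI; first exact: open_nbhs_nbhs (conj (@chart_cod_open _ _ _ _) yc).
apply: (chart_inv_continuous yc).
exact: open_nbhs_nbhs.
Qed.

Lemma chart_image_mem i (U : set M) x : chart_dom (atlas M i) x -> U x ->
  chart_image (atlas M i) U (chart_fun (atlas M i) x).
Proof.
by move=> ix Ux; split; [exact: chart_fun_cod|rewrite chart_funK].
Qed.

Lemma transition_differentiable i j x :
  chart_dom (atlas M i) x -> chart_dom (atlas M j) x ->
  differentiable (transition i j) (chart_fun (atlas M i) x).
Proof.
by move=> ix jx; apply: (@atlas_smooth _ _ M i j 1%N).1; exact: chart_image_mem.
Qed.

Lemma transition_fun i j x :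
  chart_dom (atlas M i) x ->
  transition i j (chart_fun (atlas M i) x) = chart_fun (atlas M j) x.
Proof. by move=> ix; rewrite /transition /= chart_funK. Qed.

Lemma diff_chart_change (W : normedModType R) (F : M -> W) i j x
    (v : 'rV[R]_n) :
  chart_dom (atlas M i) x -> chart_dom (atlas M j) x ->
  differentiable (F \o chart_inv (atlas M j)) (chart_fun (atlas M j) x) ->
  differentiable (F \o chart_inv (atlas M i)) (chart_fun (atlas M i) x) /\
  'd (F \o chart_inv (atlas M i)) (chart_fun (atlas M i) x) v =
  'd (F \o chart_inv (atlas M j)) (chart_fun (atlas M j) x)
     ('d (transition i j) (chart_fun (atlas M i) x) v).
Proof.
move=> ix jx dF; have dt := transition_differentiable ix jx.
have dF' : differentiable (F \o chart_inv (atlas M j))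
    (transition i j (chart_fun (atlas M i) x)) by rewrite transition_fun.
have dc := differentiable_comp dt dF'.
have E : \forall y \near chart_fun (atlas M i) x,
    (F \o chart_inv (atlas M j) \o transition i j) y =
    (F \o chart_inv (atlas M i)) y.
  have oj := chart_image_open (i := i) (chart_dom_open (atlas M j)).
  have := open_nbhs_nbhs (conj oj (chart_image_mem ix jx)).
  by apply: filterS => y [yc yj]; rewrite /transition /= chart_funK.
have [dG dGE] := near_eq_diff E dc.
split; first exact: dG.
apply: etrans (congr1 (@^~ v) dGE) _.
apply: etrans (congr1 (@^~ v) (diff_comp dt dF')) _.
by rewrite /= transition_fun.
Qed.

Lemma transition_cocycle i j k x (v : 'rV[R]_n) :
  chart_dom (atlas M i) x -> chart_dom (atlas M j) x ->
  chart_dom (atlas M k) x ->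
  'd (transition i k) (chart_fun (atlas M i) x) v =
  'd (transition j k) (chart_fun (atlas M j) x)
     ('d (transition i j) (chart_fun (atlas M i) x) v).
Proof.
move=> ix jx kx.
exact: (diff_chart_change v ix jx (transition_differentiable jx kx)).2.
Qed.

Lemma transition_id i x (v : 'rV[R]_n) : chart_dom (atlas M i) x ->
  'd (transition i i) (chart_fun (atlas M i) x) v = v.
Proof.
move=> ix.
have E : \forall y \near chart_fun (atlas M i) x, id y = transition i i y.
  have := open_nbhs_nbhs
    (conj (@chart_cod_open _ _ _ (atlas M i)) (chart_fun_cod ix)).
  by apply: filterS => y yc; rewrite /transition /= chart_invK.
have [di iE] := is_diff_id (chart_fun (atlas M i) x).
apply: etrans (congr1 (@^~ v) (near_eq_diff E di).2) _.
by rewrite iE.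
Qed.

(* The tangent vector at [x] with component vector [v] in [chart_at x]. *)
Definition tangent_of_components x (v : 'rV[R]_n) j : 'rV[R]_n :=
  if `[< chart_dom (atlas M j) x >]
  then 'd (transition (chart_at x) j) (chart_fun (atlas M (chart_at x)) x) v
  else 0.

Lemma tangent_of_componentsP x v :
  tangent_of_components x v \in tangent_pred x.
Proof.
rewrite /tangent_of_components; apply/asboolP; split=> [i nix|i j ix jx].
  by case: asboolP.
case: asboolP => // _; case: asboolP => // _.
exact: (transition_cocycle v (chart_atP x) ix jx).
Qed.

Lemma tangent_vect_axiom x : Vector.axiom n (tangent x).
Proof.
exists (fun v : tangent x => v (chart_at x)) => //.
have cx := chart_atP x.
exists (fun v => Tangent (tangent_of_componentsP x v)) => [v|v].
  apply/val_inj/funext => j /=; rewrite /tangent_of_components.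
  case: asboolP => jx; first exact: (esym (tangentE v cx jx)).
  by rewrite tangent_out.
rewrite /= /tangent_of_components; case: asboolP => // _.
exact: transition_id.
Qed.

HB.instance Definition _ x :=
  Lmodule_hasFinDim.Build R (tangent x) (tangent_vect_axiom x).

Definition vector_field := forall x, tangent x.

(* Smoothness on an open set [U]: in every chart, the coordinate
   representation is smooth on the part of the chart covering [U]. *)
Definition smooth_fun (U : set M) (J : M -> R) : Prop :=
  forall i, smooth_on (chart_image (atlas M i) U) (J \o chart_inv (atlas M i)).

Definition smooth_vf (U : set M) (X : vector_field) : Prop :=
  forall i, smooth_on (chart_image (atlas M i) U)
                      (fun y => X (chart_inv (atlas M i) y) i).

(* Computed in [chart_at x]; any other chart at [x] gives the same value, see
   [differentialE]. *)
Definition differential (J : M -> R) x (v : tangent x) : R :=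
  'd (J \o chart_inv (atlas M (chart_at x)))
     (chart_fun (atlas M (chart_at x)) x) (v (chart_at x)).

Lemma differentialE (U : set M) (J : M -> R) i x (v : tangent x) :
  smooth_fun U J -> U x -> chart_dom (atlas M i) x ->
  differential J v =
  'd (J \o chart_inv (atlas M i)) (chart_fun (atlas M i) x) (v i).
Proof.
move=> sJ Ux ix; have cx := chart_atP x.
have dJ :
    differentiable (J \o chart_inv (atlas M i)) (chart_fun (atlas M i) x).
  by apply: (sJ i 1%N).1; exact: chart_image_mem.
apply: etrans (diff_chart_change (v (chart_at x)) cx ix dJ).2 _.
exact: congr1 (esym (tangentE v cx ix)).
Qed.

Definition lie_derivative (X : vector_field) (J : M -> R) x : R :=
  differential J (X x).

Definition distribution := forall x, {vspace tangent x}.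

Definition span_distribution d (X : 'I_d -> vector_field) : distribution :=
  fun x => <<[seq X p x | p : 'I_d]>>%VS.

Definition smooth_distribution (U : set M) (E : distribution) : Prop :=
  forall x, U x -> exists V : set M, [/\ open V, V x, V `<=` U &
    exists d (X : 'I_d -> vector_field), (forall p, smooth_vf V (X p)) /\
      forall y, V y -> E y = span_distribution X y].

Definition regular_distribution (U : set M) (E : distribution) : Prop :=
  smooth_distribution U E /\ exists r, forall x, U x -> \dim (E x) = r.

Definition metric_field := forall x, tangent x -> tangent x -> R.

(* The last clause says that in every chart g = \sum_(a, b) G_ab dx^a dx^b with
   smooth coefficients G_ab. *)
Definition riemannian_metric (U : set M) (g : metric_field) : Prop :=
  [/\ forall x, U x -> forall u v : tangent x, g x u v = g x v u,
      forall x, U x -> forall a (u v w : tangent x),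
        g x (a *: u + v) w = a * g x u w + g x v w,
      forall x, U x -> forall v : tangent x, v != 0 -> 0 < g x v v &
      forall i, exists G : 'rV[R]_n -> 'M[R]_n,
        (forall a b, smooth_on (chart_image (atlas M i) U) (fun y => G y a b))
        /\ forall y, chart_image (atlas M i) U y ->
             forall u v : tangent (chart_inv (atlas M i) y),
               g _ u v = \sum_a \sum_b G y a b * u i 0 a * v i 0 b].

Definition is_gradient (U : set M) (g : metric_field) (J : M -> R)
    (V : vector_field) : Prop :=
  smooth_vf U V /\
  forall X, smooth_vf U X ->
    forall x, U x -> g x (V x) (X x) = differential J (X x).

(* For [g] a Riemannian metric on [U] and [J] smooth on [U], the gradient exists
   and is unique on [U]; outside [U] its value is irrelevant. *)
Definition grad (U : set M) (g : metric_field) (J : M -> R) : vector_field :=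
  if pselect (exists V, is_gradient U g J V) is left h then projT1 (cid h)
  else fun x => 0.

(* The [h]-orthogonal projection onto [E], i.e. the unique w in E such that v - w
   is orthogonal to E; it exists when [h] is an inner product. *)
Definition orthogonal_proj x (h : tangent x -> tangent x -> R)
    (E : {vspace tangent x}) (v : tangent x) : tangent x :=
  xget 0 [set w | w \in E /\ forall e, e \in E -> h (v - w) e = 0].

Definition grad_along (U : set M) (g : metric_field) (E : distribution)
    (J : M -> R) : vector_field :=
  fun x => orthogonal_proj (g x) (E x) (grad U g J x).

End Tangent.

(* Main.v *)
Require Import Defs.
From HB Require Import structures.
From mathcomp Require Import all_boot all_order all_algebra.
From mathcomp Require Import all_classical all_reals all_analysis.

(** The vector fields f_ij define on each cotangent space the symmetric form
    (a, b) |-> sum_ij a(f_ij) b(f_ij). It is positive definite because the f_ij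
    span the tangent space, so it is the dual of an inner product g on the
    tangent space. Equivalently, [sharp l] = sum_ij l(f_ij) f_ij is the
    g-Riesz representative of the covector l ([frame_metric_sharp]), and hence
    grad J = sum_ij L_{f_ij}(J) f_ij.

    The point is that the E_i are pairwise g-orthogonal
    ([frame_metric_orthogonal]). Let v be in E_k and a = g(v, .), so that
    v = sum_ij a(f_ij) f_ij. As the sum of the E_i is direct, the m-th part of
    this decomposition vanishes for m <> k: sum_j a(f_mj) f_mj = 0. Applying a
    gives sum_j a(f_mj)^2 = 0, so a kills E_m. Consequently the
    g-orthogonal projection of grad J onto E_i is its i-th part
    sum_j L_{f_ij}(J) f_ij, and the two vector fields agree term by term.

    In a chart, the Gram matrix of g is the inverse of sum_ij f_ij^T f_ij; its
    entries are smooth by the quotient rule and Cramer's formula. That g does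
    not depend on the chart, and is symmetric and positive definite, is read
    off from the coordinate-free characterization by [sharp]. *)

Set Implicit Arguments.
Unset Strict Implicit.
Unset Printing Implicit Defensive.

Import Order.TTheory GRing.Theory Num.Theory.
Import numFieldNormedType.Exports.

Local Open Scope classical_set_scope.
Local Open Scope ring_scope.

(** * The inner product dual to a spanning family *)

Section FrameMetric.
Context {R : realFieldType} {V : vectType R} {n N : nat} {d : 'I_N -> nat}.
Variables (f : forall i, 'I_(d i) -> V) (phi : {linear V -> 'rV[R]_n}).
Arguments f : clear implicits.

Local Notation E i := (<<[seq f i p | p : 'I_(d i)]>>%VS).

Definition sharp_block (l : V -> R) k : V := \sum_(j < d k) l (f k j) *: f k j.

(** The map from covectors to vectors induced by the form
    (a, b) |-> sum_ij a(f_ij) b(f_ij), sorted by the summands E_k. *)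
Definition sharp (l : V -> R) : V := \sum_(i < N) sharp_block l i.

(** The matrix of that form in the coordinates [phi]. *)
Definition cometric : 'M[R]_n :=
  \sum_(i < N) \sum_(j < d i) (phi (f i j))^T *m phi (f i j).

Definition frame_metric (u v : V) : R :=
  (phi u *m invmx cometric *m (phi v)^T) 0 0.

Lemma frame_metric_is_linear u : linear (frame_metric u : V -> R^o).
Proof.
by move=> a v w; rewrite /frame_metric linearP linearP linearP/= !mxE.
Qed.

HB.instance Definition _ u :=
  GRing.isLinear.Build R V R^o *:%R (frame_metric u) (frame_metric_is_linear u).

Lemma memv_frame i j : f i j \in E i.
Proof. by apply: memv_span; apply: map_f; rewrite mem_enum. Qed.

Lemma memv_sharp_block l k : sharp_block l k \in E k.
Proof. by apply: memv_suml => j _; apply: memvZ; exact: memv_frame. Qed.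

Lemma linear_span_eq0 (W : vectType R) (l : {linear V -> W}) k :
  (forall j, l (f k j) = 0) -> {in E k, forall v, l v = 0}.
Proof.
move=> l0 v vE; rewrite -lfunE; apply/eqP; rewrite -memv_ker.
have /subvP : (E k <= lker (linfun l))%VS; last exact.
by apply/span_subvP => _ /mapP[j _ ->]; rewrite memv_ker lfunE/= l0.
Qed.

Hypothesis phi_bij : bijective phi.
Hypothesis E_sum : (\sum_(i < N) E i)%VS = fullv.

Lemma linear_eq0_on_frame (W : vectType R) (l : {linear V -> W}) :
  (forall i j, l (f i j) = 0) -> forall v, l v = 0.
Proof.
move=> l0 v; have : v \in (\sum_(i < N) E i)%VS by rewrite E_sum memvf.
move=> /memv_sumP[w wE ->]; rewrite linear_sum big1// => i _.
exact: (linear_span_eq0 (l0 i) (wE i isT)).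
Qed.

(** In coordinates, the covector [w] is sent by [sharp] to [w *m cometric]:
    [cometric] is the matrix of [sharp]. *)
Lemma phi_sharp (w : 'rV[R]_n) :
  phi (sharp (fun v => (w *m (phi v)^T) 0 0)) = w *m cometric.
Proof.
rewrite /sharp /cometric linear_sum mulmx_sumr; apply: eq_bigr => i _.
rewrite linear_sum mulmx_sumr; apply: eq_bigr => j _.
rewrite linearZ/= mulmxA [w *m _]mx11_scalar mul_scalar_mx.
by rewrite mxE eqxx mulr1n.
Qed.

Lemma covector_coordinates (l : {linear V -> R^o}) :
  exists w : 'rV[R]_n, forall v, l v = (w *m (phi v)^T) 0 0.
Proof.
have [psi phiK psiK] := phi_bij.
exists (\row_b l (psi (delta_mx 0 b))) => v.
have {1}-> : v = \sum_b phi v 0 b *: psi (delta_mx 0 b).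
  apply: (can_inj phiK); rewrite linear_sum [LHS]row_sum_delta.
  by apply: eq_bigr => b _; rewrite linearZ/= psiK.
rewrite linear_sum/= mxE; apply: eq_bigr => b _.
by rewrite linearZ/= !mxE mulrC.
Qed.

Lemma cometric_quadratic (w : 'rV[R]_n) :
  (w *m cometric *m w^T) 0 0 =
  \sum_(i < N) \sum_(j < d i) ((w *m (phi (f i j))^T) 0 0) ^+ 2.
Proof.
rewrite /cometric mulmx_sumr mulmx_suml summxE; apply: eq_bigr => i _.
rewrite mulmx_sumr mulmx_suml summxE; apply: eq_bigr => j _.
rewrite mulmxA -mulmxA -[X in _ *m X]trmxK trmx_mul trmxK.
by rewrite mxE big_ord1 [in X in _ * X]mxE expr2.
Qed.

Lemma sum_sqr_frame_eq0 (c : forall i, 'I_(d i) -> R) :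
  \sum_(i < N) \sum_(j < d i) c i j ^+ 2 = 0 -> forall i j, c i j = 0.
Proof.
move=> /eqP; rewrite psumr_eq0 => [/allP c0 i j|i _]; last first.
  by apply: sumr_ge0 => j _; exact: sqr_ge0.
have /implyP/(_ isT) := c0 i (mem_index_enum i).
rewrite psumr_eq0 => [/allP/(_ j (mem_index_enum j))|? _]; last exact: sqr_ge0.
by rewrite sqrf_eq0 => /eqP.
Qed.

(** A covector in the kernel kills every f_ij, since the quadratic form is a sum
    of squares; hence it kills their span, which is everything. *)
Lemma cometric_unit : cometric \in unitmx.
Proof.
rewrite -row_free_unit; apply/inj_row_free => w wP.
have := cometric_quadratic w; rewrite wP mul0mx mxE => /esym.
move=> /(@sum_sqr_frame_eq0 (fun i j => (w *m (phi (f i j))^T) 0 0)) w0.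
have lin : linear (fun v => (w *m (phi v)^T) 0 0 : R^o).
  by move=> a u v; rewrite linearP linearP linearP/= !mxE.
pose L := GRing.isLinear.Build R V R^o *:%R _ lin.
pose l : {linear V -> R^o} := HB.pack (fun v => (w *m (phi v)^T) 0 0) L.
have l0 := @linear_eq0_on_frame _ l w0.
have [psi phiK psiK] := phi_bij.
apply/rowP => b; have := l0 (psi (delta_mx 0 b)).
by rewrite /= psiK trmx_delta -colE !mxE.
Qed.

(** [sharp l] is the Riesz representative of [l]: in coordinates the Gram matrix
    cancels [cometric]. *)
Lemma frame_metric_sharp (l : {linear V -> R^o}) v :
  frame_metric (sharp l) v = l v.
Proof.
have [w lE] := covector_coordinates l.
have -> : sharp l = sharp (fun v => (w *m (phi v)^T) 0 0).
  by congr sharp; apply/funext.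
by rewrite /frame_metric phi_sharp mulmxK ?cometric_unit// lE.
Qed.

Lemma sharp_frame_metric u : sharp (frame_metric u) = u.
Proof.
apply: (bij_inj phi_bij); rewrite phi_sharp.
by rewrite mulmxKV ?cometric_unit.
Qed.

(** Expand [v] as [sharp (frame_metric v)]. This writes the metric as a sum of
    products, from which symmetry and positivity are immediate. *)
Lemma frame_metricE u v : frame_metric u v =
  \sum_(i < N) \sum_(j < d i) frame_metric u (f i j) * frame_metric v (f i j).
Proof.
rewrite -[in LHS](sharp_frame_metric v) linear_sum; apply: eq_bigr => i _.
by rewrite linear_sum; apply: eq_bigr => j _; rewrite linearZ/= mulrC.
Qed.

Lemma frame_metricC u v : frame_metric u v = frame_metric v u.
Proof.
rewrite frame_metricE [RHS]frame_metricE.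
by apply: eq_bigr => i _; apply: eq_bigr => j _; rewrite mulrC.
Qed.

Lemma frame_metric_ge0 v : 0 <= frame_metric v v.
Proof.
rewrite frame_metricE.
by apply: sumr_ge0 => i _; apply: sumr_ge0 => j _; rewrite -expr2 sqr_ge0.
Qed.

Lemma frame_metric_eq0 v : frame_metric v v = 0 -> v = 0.
Proof.
rewrite frame_metricE => v0; rewrite -[v]sharp_frame_metric.
rewrite /sharp big1// => i _; rewrite /sharp_block big1// => j _.
have v0' : \sum_(i < N) \sum_(j < d i) frame_metric v (f i j) ^+ 2 = 0.
  by rewrite -[RHS]v0; do 2!apply: eq_bigr => ? _; rewrite expr2.
by rewrite (sum_sqr_frame_eq0 v0') scale0r.
Qed.

Hypothesis E_direct : directv (\sum_(i < N) E i)%VS.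

(** Only the k-th part of v = [sharp (frame_metric v)] can be nonzero, by
    directness of the sum; pairing the m-th part with v gives a sum of squares
    equal to 0. *)
Lemma frame_metric_orthogonal k m v j :
  m != k -> v \in E k -> frame_metric v (f m j) = 0.
Proof.
move=> mk vE.
have /directv_sum_independent dE := E_direct.
(* The decomposition of v - v with parts w i: all of them vanish. *)
pose w i := sharp_block (frame_metric v) i - (if i == k then v else 0).
have wE i : true -> w i \in E i.
  move=> _; rewrite /w memvB ?memv_sharp_block//.
  by case: eqVneq => [->//|_]; rewrite mem0v.
have w0 : \sum_i w i = 0.
  rewrite sumrB -big_mkcond/= big_pred1_eq; apply/eqP; rewrite subr_eq0.
  by apply/eqP; exact: sharp_frame_metric.
have := dE w wE w0 m isT; rewrite /w (negbTE mk) subr0.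
move=> /(congr1 (frame_metric v)); rewrite linear0 linear_sum/=.
under eq_bigr do rewrite linearZ/= -[_ *: _]/(_ * _) -expr2.
move=> /eqP; rewrite psumr_eq0 => [/allP/(_ j (mem_index_enum j))|? _].
  by rewrite sqrf_eq0 => /eqP.
exact: sqr_ge0.
Qed.

(** Hence [sharp_block l k] is the orthogonal projection of [sharp l] onto E_k. *)
Lemma sharp_block_orthogonal l k e :
  e \in E k -> frame_metric (sharp l - sharp_block l k) e = 0.
Proof.
move=> eE; rewrite frame_metricC /sharp (bigD1 k)//= addrC addrK linear_sum.
rewrite big1// => m mk; rewrite linear_sum big1// => j _.
by rewrite linearZ/= (frame_metric_orthogonal j mk eE) scaler0.
Qed.

Lemma orthogonal_proj_unique k v w w' :
  w \in E k -> (forall e, e \in E k -> frame_metric (v - w) e = 0) ->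
  w' \in E k -> (forall e, e \in E k -> frame_metric (v - w') e = 0) ->
  w = w'.
Proof.
move=> wE w0 w'E w'0; apply/subr0_eq/frame_metric_eq0.
have eE : w - w' \in E k by exact: memvB.
rewrite -[X in frame_metric X _](subrKA v) -opprB addrC frame_metricC.
by rewrite linearD/= linearN/= frame_metricC w'0// frame_metricC w0// oppr0 addr0.
Qed.

End FrameMetric.

(** Both metrics have the same Riesz isomorphism, namely [sharp], whose definition
    does not mention coordinates. *)
Lemma frame_metric_coordinate_free (R : realFieldType) (V : vectType R)
    (n n' N : nat) (d : 'I_N -> nat) (f : forall i, 'I_(d i) -> V)
    (phi : {linear V -> 'rV[R]_n}) (phi' : {linear V -> 'rV[R]_n'}) u v :
  bijective phi -> bijective phi' ->
  (\sum_(i < N) <<[seq f i p | p : 'I_(d i)]>>)%VS = fullv ->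
  frame_metric f phi u v = frame_metric f phi' u v.
Proof.
move=> bphi bphi' sE.
rewrite -{2}(sharp_frame_metric bphi sE u).
exact/esym/(frame_metric_sharp bphi' sE).
Qed.

(** * Smooth functions on an open set *)

Section CkCalculus.
Context {R : realType} {V : normedModType R}.
Implicit Types (W : normedModType R) (O : set V).

Lemma Ck_subset W k O O' (f : V -> W) : O' `<=` O -> Ck k O f -> Ck k O' f.
Proof.
move=> OO'; elim: k f => [|k IH] f /=; first by move=> + x /OO' Ox; apply.
by move=> [df Df]; split=> [x /OO'|v]; [exact: df|exact: IH].
Qed.

Lemma Ck_ext W k O (f g : V -> W) :
  open O -> (forall x, O x -> f x = g x) -> Ck k O f -> Ck k O g.
Proof.
move=> oO; elim: k f g => [|k IH] f g fg /=.
  move=> cf x Ox; have := cf x Ox; rewrite /prop_for /= /continuous_at -fg//.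
  apply: cvg_trans; apply: near_eq_cvg.
  have := open_nbhs_nbhs (conj oO Ox).
  by apply: filterS => y /fg ->.
move=> [df Df].
have H x : O x -> differentiable g x /\ 'd g x = 'd f x :> (V -> W).
  move=> Ox; apply: near_eq_diff (df x Ox).
  by have := open_nbhs_nbhs (conj oO Ox); apply: filterS => y /fg.
split=> [x Ox|v]; first exact: (H x Ox).1.
apply: IH (Df v) => x Ox; have [dg dgE] := H x Ox.
apply: etrans (deriveE v (df x Ox)) _.
apply: etrans _ (esym (deriveE v dg)).
apply: esym; apply: etrans (congr1 (@^~ v) dgE) _.
by [].
Qed.

Lemma CkS W k O (f : V -> W) : Ck k.+1 O f -> Ck k O f.
Proof.
elim: k f => [|k IH] f [df Df].
  by move=> x /df; exact: differentiable_continuous.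
by split=> // v; apply: IH; exact: Df.
Qed.

Lemma Ck_cst W k O (a : W) : Ck k O (cst a).
Proof.
elim: k a => [|k IH] a /=; first by move=> x _; exact: cvg_cst.
split=> [x _|v]; first exact: differentiable_cst.
rewrite (_ : 'D_v _ = cst 0) ?IH//.
by apply/funext => x; rewrite derive_cst.
Qed.

Lemma CkD W k O (f g : V -> W) : open O ->
  Ck k O f -> Ck k O g -> Ck k O (fun x => f x + g x).
Proof.
move=> oO; elim: k f g => [|k IH] f g /=.
  by move=> cf cg x Ox; apply: cvgD; [exact: cf|exact: cg].
move=> [df Df] [dg Dg]; split=> [x Ox|v].
  by apply: differentiableD; [exact: df|exact: dg].
apply: Ck_ext (IH _ _ (Df v) (Dg v)) => // x Ox.
by rewrite deriveD//; apply: diff_derivable; [exact: df|exact: dg].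
Qed.

Lemma CkM k O (f g : V -> R) : open O ->
  Ck k O f -> Ck k O g -> Ck k O (fun x => f x * g x).
Proof.
move=> oO; elim: k f g => [|k IH] f g.
  by move=> cf cg x Ox; apply: cvgM; [exact: cf|exact: cg].
move=> cf cg; have [[df Df] [dg Dg]] := (cf, cg); split=> [x Ox|v].
  by apply: differentiableM; [exact: df|exact: dg].
apply: Ck_ext (CkD oO (IH _ _ (CkS cf) (Dg v)) (IH _ _ (CkS cg) (Df v))) => //.
move=> x Ox; rewrite deriveM//; apply: diff_derivable; [exact: df|exact: dg].
Qed.

(** By induction on the order: (1/f)' = - (1/f) (1/f) f' involves 1/f only to the
    previous order. *)
Lemma CkV k O (f : V -> R) : open O -> (forall x, O x -> f x != 0) ->
  Ck k O f -> Ck k O (fun x => (f x)^-1).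
Proof.
move=> oO f0; elim: k => [|k IH] cf.
  by move=> x Ox; apply: cvgV; [exact: f0|exact: cf].
have [df Df] := cf; split=> [x Ox|v].
  by apply: differentiableV; [exact: df|exact: f0].
have cV := IH (CkS cf).
apply: Ck_ext (CkM oO (CkM oO (@Ck_cst R^o k O (-1)) (CkM oO cV cV)) (Df v)) => //.
move=> x Ox; rewrite deriveV; last 2 first.
- exact: f0.
- by apply: diff_derivable; exact: df.
by rewrite /= mulN1r expr2 invfM.
Qed.

Lemma Ck_linear_comp W W' k O (L : {linear W -> W'}) (f : V -> W) :
  open O -> continuous L -> Ck k O f -> Ck k O (L \o f).
Proof.
move=> oO cL; elim: k f => [|k IH] f.
  by move=> cf x Ox; apply: continuous_comp; [exact: cf|exact: cL].
move=> [df Df].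
have dL y : differentiable L y by exact: linear_differentiable.
split=> [x Ox|v].
  by apply: differentiable_comp; [exact: df|exact: dL].
apply: Ck_ext (IH _ (Df v)) => // x Ox.
have dfx := df x Ox.
apply: etrans (congr1 (fun z => L z) (deriveE v dfx)) _.
apply: etrans _ (esym (deriveE v (differentiable_comp dfx (dL (f x))))).
apply: etrans _ (esym (congr1 (@^~ v) (diff_comp dfx (dL (f x))))).
exact: (esym (congr1 (@^~ ('d f x v)) (diff_lin (f x) cL))).
Qed.

End CkCalculus.

Section CkMatrix.
Context {R : realType} {V : normedModType R} (O : set V) (oO : open O) (k : nat).

Lemma Ck_sum (W : normedModType R) (I : Type) (r : seq I) (P : pred I) (F : I -> V -> W) :
  (forall i, Ck k O (F i)) -> Ck k O (fun x => \sum_(i <- r | P i) F i x).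
Proof.
move=> cF; elim: r => [|i r IH].
  by under eq_fun do rewrite big_nil; exact: Ck_cst.
under eq_fun do rewrite big_cons; case: (P i) => //.
exact: CkD.
Qed.

Lemma Ck_prod (I : Type) (r : seq I) (P : pred I) (F : I -> V -> R) :
  (forall i, Ck k O (F i)) -> Ck k O (fun x => \prod_(i <- r | P i) F i x).
Proof.
move=> cF; elim: r => [|i r IH].
  by under eq_fun do rewrite big_nil; exact: (@Ck_cst _ _ R^o).
under eq_fun do rewrite big_cons; case: (P i) => //.
exact: CkM.
Qed.

Lemma Ck_det m (A : V -> 'M[R]_m) :
  (forall a b, Ck k O (fun x => A x a b)) -> Ck k O (fun x => \det (A x)).
Proof.
move=> cA; apply: Ck_sum => s; apply: CkM => //; last exact: Ck_prod.
exact: (@Ck_cst _ _ R^o).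
Qed.

Lemma Ck_invmx m (A : V -> 'M[R]_m) a b :
  (forall x, O x -> A x \in unitmx) ->
  (forall a b, Ck k O (fun x => A x a b)) -> Ck k O (fun x => invmx (A x) a b).
Proof.
move=> uA cA.
apply: (@Ck_ext _ _ _ _ _ (fun x => (\det (A x))^-1 * \adj (A x) a b)) => //.
  by move=> x Ox; rewrite /invmx uA// [RHS]mxE.
apply: CkM => //.
  apply: CkV => //; last exact: Ck_det.
  by move=> x /uA; rewrite unitmxE unitfE.
under eq_fun do rewrite mxE; apply: CkM => //; first exact: (@Ck_cst _ _ R^o).
by apply: Ck_det => a' b'; under eq_fun do rewrite !mxE.
Qed.

Lemma Ck_coord m (w : V -> 'rV[R]_m) b :
  Ck k O w -> Ck k O (fun x => w x 0 b).
Proof.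
have lin : linear (fun v : 'rV[R]_m => v 0 b : R^o) by move=> a u v; rewrite !mxE.
pose L := GRing.isLinear.Build R 'rV[R]_m R^o *:%R _ lin.
pose l : {linear 'rV[R]_m -> R^o} := HB.pack (fun v : 'rV[R]_m => v 0 b) L.
apply: (@Ck_linear_comp _ _ _ _ _ _ l) => //.
exact: (@coord_continuous R 1 m 0 b).
Qed.

(** A row vector field is the sum of its entries times constant vectors, and
    scaling a constant vector is a continuous linear map. *)
Lemma Ck_row m (w : V -> 'rV[R]_m) :
  (forall b, Ck k O (fun x => w x 0 b)) -> Ck k O w.
Proof.
move=> cw.
apply: (@Ck_ext _ _ _ _ _ (fun x => \sum_b w x 0 b *: delta_mx 0 b)) => //.
  by move=> x _; rewrite -row_sum_delta.
apply: Ck_sum => b.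
have lin : linear (fun c : R^o => c *: (delta_mx 0 b : 'rV[R]_m)).
  by move=> a u v; rewrite scalerDl scalerA.
pose L := GRing.isLinear.Build R R^o 'rV[R]_m *:%R _ lin.
pose l : {linear R^o -> 'rV[R]_m} :=
  HB.pack (fun c : R^o => c *: (delta_mx 0 b : 'rV[R]_m)) L.
apply: (@Ck_linear_comp _ _ _ _ _ _ l) => //.
exact: (@scalel_continuous R 'rV[R]_m (delta_mx 0 b)).
Qed.

Lemma CkZ m (f : V -> R) (w : V -> 'rV[R]_m) :
  Ck k O f -> Ck k O w -> Ck k O (fun x => f x *: w x).
Proof.
move=> cf cw; apply: Ck_row => b; under eq_fun do rewrite mxE.
by apply: CkM => //; exact: Ck_coord.
Qed.

End CkMatrix.

(** * Tangent vectors in charts *)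

Section ChartCoordinates.
Context {R : realType} {n : nat} {M : smooth_manifold R n}.

Definition chart_vec (x : M) (i : atlas_index M) (v : tangent x) : 'rV[R]_n :=
  v i.
Arguments chart_vec : clear implicits.

Lemma chart_vec_is_linear x i : linear (chart_vec x i).
Proof. by []. Qed.

HB.instance Definition _ x i :=
  GRing.isLinear.Build R (tangent x) 'rV[R]_n *:%R (chart_vec x i)
    (@chart_vec_is_linear x i).

(** The preimage of a coordinate vector [w] in chart [i] is built from its
    transport to the distinguished chart [chart_at x]; the cocycle rule brings
    it back to [w]. *)
Lemma chart_vec_bij x i :
  chart_dom (atlas M i) x -> bijective (chart_vec x i).
Proof.
move=> ix; have cx := chart_atP x.
pose psi w := Tangent (tangent_of_componentsP x
  ('d (transition i (chart_at x)) (chart_fun (atlas M i) x) w)).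
have psiK : cancel psi (chart_vec x i).
  move=> w; rewrite /chart_vec /= /tangent_of_components asboolT//.
  by rewrite -(transition_cocycle w ix cx ix) transition_id.
exists psi => // v; apply/val_inj/funext => j /=.
rewrite /tangent_of_components; case: asboolP => jx; last by rewrite tangent_out.
apply: etrans _ (esym (tangentE v cx jx)).
exact: congr1 (esym (tangentE v ix cx)).
Qed.

Lemma differential_is_linear (J : M -> R) x :
  linear (@differential R n M J x : tangent x -> R^o).
Proof. by move=> a u v; rewrite /differential componentsD componentsZ linearP. Qed.

HB.instance Definition _ (J : M -> R) x :=
  GRing.isLinear.Build R (tangent x) R^o *:%R (@differential R n M J x)
    (@differential_is_linear J x).

(** In a chart, L_X J is the sum of the components of X times the partial
    derivatives of J, which are smooth by definition of [Ck]. *)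
Lemma lie_derivative_smooth (U : set M) (X : vector_field M) (J : M -> R) :
  open U -> smooth_vf U X -> smooth_fun U J ->
  smooth_fun U (lie_derivative X J).
Proof.
move=> oU sX sJ c k; have oI := chart_image_open (i := c) oU.
apply: (@Ck_ext _ _ _ _ _ (fun y => \sum_b X (chart_inv (atlas M c) y) c 0 b *
    'D_(delta_mx 0 b) (J \o chart_inv (atlas M c)) y)) => //; last first.
  apply: Ck_sum => // b; apply: CkM => //.
    by apply: Ck_coord => //; exact: sX.
  exact: (sJ c k.+1).2.
move=> y [yc yU]; rewrite /lie_derivative /=.
rewrite (differentialE _ sJ yU (chart_inv_dom yc)) chart_invK//.
have dJ := (sJ c 1%N).1 y (conj yc yU).
rewrite [X in 'd _ _ X]row_sum_delta linear_sum.
by apply: eq_bigr => b _; rewrite linearZ/= (deriveE _ dJ).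
Qed.

Lemma smooth_vfB (U : set M) (X Y : vector_field M) :
  open U -> smooth_vf U X -> smooth_vf U Y ->
  smooth_vf U (fun x => X x - Y x).
Proof.
move=> oU sX sY c k; have oI := chart_image_open (i := c) oU.
apply: (@Ck_ext _ _ _ _ _ (fun y => X (chart_inv (atlas M c) y) c +
  (-1) *: Y (chart_inv (atlas M c) y) c)) => //.
  by move=> y _; rewrite scaleN1r.
apply: CkD => //; first exact: sX.
by apply: CkZ => //; [exact: (@Ck_cst _ _ R^o)|exact: sY].
Qed.

End ChartCoordinates.
Arguments chart_vec {R n M} x i v.

(** * The metric of a spanning family of vector fields *)

Section SpanningFrame.
Context {R : realType} {n : nat} {M : smooth_manifold R n}.
Context {N : nat} {d : 'I_N -> nat}.
Variables (f : forall i : 'I_N, 'I_(d i) -> vector_field M) (U : set M).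
Arguments f : clear implicits.
Hypothesis U_open : open U.
Hypothesis f_smooth : forall i j, smooth_vf U (f i j).
Hypothesis E_sum : forall x, U x ->
  (\sum_(i < N) span_distribution (f i) x)%VS = fullv.

Local Notation frame x := (fun i j => f i j x).

(** The definition uses one chart around each point, chosen without any
    continuity; smoothness rests on [spanning_metric_chart]. *)
Definition spanning_metric : metric_field M :=
  fun x => frame_metric (frame x) (chart_vec x (chart_at x)).

Lemma spanning_metric_chart x c (u v : tangent x) :
  U x -> chart_dom (atlas M c) x ->
  spanning_metric u v = frame_metric (frame x) (chart_vec x c) u v.
Proof.
move=> Ux cx; apply: (frame_metric_coordinate_free (f := frame x) _ _ _ _ (E_sum Ux)).
  exact/chart_vec_bij/chart_atP.
exact: chart_vec_bij.
Qed.

Lemma spanning_metric_riemannian : riemannian_metric U spanning_metric.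
Proof.
have cb (x : M) : bijective (chart_vec x (chart_at x)).
  exact/chart_vec_bij/chart_atP.
split=> [x Ux u v|x Ux a u v w|x Ux v v0|c].
- exact: (frame_metricC (f := frame x) (cb x) (E_sum Ux)).
- rewrite /spanning_metric !(frame_metricC (f := frame x) (cb x) (E_sum Ux) _ w).
  by rewrite linearP.
- rewrite lt_def (frame_metric_ge0 (f := frame x) (cb x) (E_sum Ux)) andbT.
  by apply: contra_neq v0; exact: (frame_metric_eq0 (f := frame x) (cb x) (E_sum Ux)).
pose G y := let x := chart_inv (atlas M c) y in
  invmx (cometric (frame x) (chart_vec x c)).
exists G; split=> [a b k|y [yc yU] u v].
  have oI := chart_image_open (i := c) U_open.
  apply: Ck_invmx => // [y [yc yU]|a' b'].
    apply: (cometric_unit (f := frame (chart_inv (atlas M c) y)) _ (E_sum yU)).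
    exact/chart_vec_bij/chart_inv_dom.
  under eq_fun do rewrite summxE; apply: Ck_sum => // i.
  under eq_fun do rewrite summxE; apply: Ck_sum => // j.
  under eq_fun do rewrite mxE big_ord1 mxE.
  by apply: CkM => //; apply: Ck_coord => //; exact: f_smooth.
rewrite (spanning_metric_chart _ _ yU (chart_inv_dom yc)) /frame_metric mxE.
under eq_bigr do rewrite mxE big_distrl/=.
rewrite exchange_big; apply: eq_bigr => a _; apply: eq_bigr => b _.
by rewrite mxE [u c 0 a * _]mulrC.
Qed.

Lemma sharp_is_gradient (J : M -> R) : smooth_fun U J ->
  is_gradient U spanning_metric J
    (fun x => sharp (frame x) (@differential R n M J x)).
Proof.
move=> sJ; split=> [c k|X _ x Ux].
  have oI := chart_image_open (i := c) U_open.
  apply: (@Ck_ext _ _ _ _ _ (fun y => \sum_(i < N) \sum_(j < d i)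
    lie_derivative (f i j) J (chart_inv (atlas M c) y) *:
      f i j (chart_inv (atlas M c) y) c)) => //.
    move=> y _; apply: esym.
    rewrite -[LHS]/(chart_vec _ c _) linear_sum; apply: eq_bigr => i _.
    by rewrite linear_sum; apply: eq_bigr => j _; rewrite linearZ.
  apply: Ck_sum => // i; apply: Ck_sum => // j; apply: CkZ => //.
    exact: (lie_derivative_smooth U_open (@f_smooth i j) sJ c k).
  exact: f_smooth.
apply: (frame_metric_sharp (f := frame x) _ (E_sum Ux)).
exact/chart_vec_bij/chart_atP.
Qed.

(** The difference of two gradients is itself a smooth field on [U], so it may
    be paired with itself; this avoids extending tangent vectors to fields. *)
Lemma gradient_unique (g : metric_field M) (J : M -> R) V W :
  riemannian_metric U g -> is_gradient U g J V -> is_gradient U g J W ->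
  forall x, U x -> V x = W x.
Proof.
move=> [gC gL gP _] [sV gV] [sW gW] x Ux; apply/subr0_eq/eqP.
apply: contraT => /(gP x Ux).
have := gV _ (smooth_vfB U_open sV sW) x Ux.
rewrite -(gW _ (smooth_vfB U_open sV sW) x Ux) => VW.
by rewrite -{1}scaleN1r addrC gL// mulN1r VW addNr ltxx.
Qed.

Lemma gradE (J : M -> R) x : smooth_fun U J -> U x ->
  grad U spanning_metric J x = sharp (frame x) (@differential R n M J x).
Proof.
move=> sJ Ux; have gJ := sharp_is_gradient sJ; rewrite /grad.
case: pselect => [h|[]]; last by eexists; exact: gJ.
exact: (gradient_unique spanning_metric_riemannian (projT2 (cid h)) gJ).
Qed.

Lemma grad_alongE (J : M -> R) k x : smooth_fun U J -> U x ->
  directv (\sum_(i < N) span_distribution (f i) x)%VS ->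
  grad_along U spanning_metric (span_distribution (f k)) J x =
  \sum_(j < d k) lie_derivative (f k j) J x *: f k j x.
Proof.
move=> sJ Ux Ed; rewrite /grad_along /orthogonal_proj gradE//.
have bx : bijective (chart_vec x (chart_at x)) by exact/chart_vec_bij/chart_atP.
have so e : e \in span_distribution (f k) x -> spanning_metric
    (sharp (frame x) (@differential R n M J x)
     - sharp_block (frame x) (@differential R n M J x) k) e = 0.
  exact: (sharp_block_orthogonal (f := frame x) bx (E_sum Ux) Ed).
have sE := memv_sharp_block (frame x) (@differential R n M J x) k.
apply: xget_unique => [|w [wE w0]]; first by split.
exact: (orthogonal_proj_unique (f := frame x) bx (E_sum Ux) wE w0 sE so).
Qed.

End SpanningFrame.

Theorem theorem1 (R : realType) (n : nat) (M : smooth_manifold R n)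
    (N : nat) (d : 'I_N -> nat)
    (f : forall i : 'I_N, 'I_(d i) -> vector_field M)
    (J : 'I_N -> M -> R) (kappa : 'I_N -> R) (U : set M)
    (f_smooth : forall i j, smooth_vf [set: M] (f i j))
    (J_smooth : forall i, smooth_fun [set: M] (J i))
    (kappa_gt0 : forall i, 0 < kappa i)
    (U_open : open U)
    (E_regular : forall i, regular_distribution U (span_distribution (f i)))
    (E_sum : forall x, U x ->
       (\sum_(i < N) span_distribution (f i) x)%VS = fullv)
    (E_direct : forall x, U x ->
       directv (\sum_(i < N) span_distribution (f i) x)%VS) :
  exists g : metric_field M, riemannian_metric U g /\
    forall x, U x ->
      \sum_(i < N) kappa i *:
          (\sum_(j < d i) lie_derivative (f i j) (J i) x *: f i j x) =
      \sum_(i < N) kappa i *: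
          grad_along U g (span_distribution (f i)) (J i) x.
Proof.
have fU i j : smooth_vf U (f i j).
  by move=> c k; apply: Ck_subset (f_smooth i j c k) => y [yc _]; split.
have JU i : smooth_fun U (J i).
  by move=> c k; apply: Ck_subset (J_smooth i c k) => y [yc _]; split.
exists (spanning_metric f); split; first exact: spanning_metric_riemannian.
move=> x Ux; apply: eq_bigr => i _.
by rewrite (grad_alongE U_open fU E_sum i (JU i) Ux (E_direct x Ux)).
Qed.
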